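(* For integers $r,s\geq 2$, \[ \log_2\left(\left\lfloor \frac{\sqrt{1+8(r-1)(s-1)}-1}{2}\right\rfloor+r+s\right)\leq\operatorname{BR}^2(\vee_r,\wedge_s)\leq \left\lceil\log_{3/2}(r+s-1)\right\rceil. \]
   Context: The $r$-cup $\vee_r$ is the 2-uniform pograph on the poset $\{x,y_1,\dots,y_r\}$ with $x\le y_i$ for all $i$ and edges $xy_i$; the $s$-cap $\wedge_s$ is the pograph on $\{y,x_1,\dots,x_s\}$ with $x_i\le y$ and edges $x_iy$. Given a coloring of the comparable pairs of a poset $Q$, a copy of $H$ in color $i$ is an injection $f:V(H)\to Q$ with $f(x)\le f(y)$ whenever $x\le y$ such that every edge of $H$ is mapped to a pair of color $i$. $\operatorname{BR}^2(G_1,G_2)$ is the least $N$ such that every 2-coloring of the comparable pairs of the Boolean lattice $B_N$ (subsets of $[N]$) contains a copy of $G_1$ in color 1 or a copy of $G_2$ in color 2. *)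

(* Defs.v *)
From HB Require Import structures.
From mathcomp Require Import all_boot all_order all_algebra.
From mathcomp Require Import all_classical all_reals all_analysis.

Set Implicit Arguments.
Unset Strict Implicit.
Unset Printing Implicit Defensive.

Import Order.DefaultSetSubsetOrder.
Import Order.TTheory GRing.Theory Num.Theory.

Local Open Scope order_scope.

Record pograph (k : nat) := Pograph {
  pg_disp : Order.disp_t;
  pg_vertex : finPOrderType pg_disp;
  pg_edges : {set {set pg_vertex}};
  pg_uniform : forall e : {set pg_vertex}, e \in pg_edges -> #|e| = k;
  pg_chain : forall e : {set pg_vertex}, e \in pg_edges ->
    {in e &, forall x y, x >=< y}
}.

Fact cup_display : Order.disp_t. Proof. exact: Order.Disp tt tt. Qed.
Fact cap_display : Order.disp_t. Proof. exact: Order.Disp tt tt. Qed.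

(* [None] is x and [Some i] is y_i. *)
Definition cup_vertex (r : nat) : Type := option 'I_r.
HB.instance Definition _ (r : nat) := Finite.on (cup_vertex r).

(* [None] is y and [Some i] is x_i. *)
Definition cap_vertex (s : nat) : Type := option 'I_s.
HB.instance Definition _ (s : nat) := Finite.on (cap_vertex s).

Definition cup_le (r : nat) : rel (cup_vertex r) :=
  fun u v => (u == v) || (u == None).

Definition cap_le (s : nat) : rel (cap_vertex s) :=
  fun u v => (u == v) || (v == None).

Lemma cup_le_refl r : reflexive (@cup_le r).
Proof. by move=> u; rewrite /cup_le eqxx. Qed.

Lemma cup_le_anti r : antisymmetric (@cup_le r).
Proof. by move=> [i|] [j|]; rewrite /cup_le //= ?orbF => /andP[/eqP]. Qed.

Lemma cup_le_trans r : transitive (@cup_le r).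
Proof. by move=> v u w /orP[/eqP ->|/eqP ->] //; rewrite /cup_le eqxx orbT. Qed.

Lemma cap_le_refl s : reflexive (@cap_le s).
Proof. by move=> u; rewrite /cap_le eqxx. Qed.

Lemma cap_le_anti s : antisymmetric (@cap_le s).
Proof. by move=> [i|] [j|]; rewrite /cap_le //= ?orbF => /andP[/eqP]. Qed.

Lemma cap_le_trans s : transitive (@cap_le s).
Proof. by move=> v u w uv /orP[/eqP <-|/eqP ->] //; rewrite /cap_le eqxx orbT. Qed.

HB.instance Definition _ (r : nat) := Order.Le_isPOrder.Build cup_display
  (cup_vertex r) (@cup_le_refl r) (@cup_le_anti r) (@cup_le_trans r).

HB.instance Definition _ (s : nat) := Order.Le_isPOrder.Build cap_display
  (cap_vertex s) (@cap_le_refl s) (@cap_le_anti s) (@cap_le_trans s).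

Definition cup_edges (r : nat) : {set {set cup_vertex r}} :=
  [set [set (None : cup_vertex r); Some i] | i : 'I_r].

Definition cap_edges (s : nat) : {set {set cap_vertex s}} :=
  [set [set (Some i : cap_vertex s); None] | i : 'I_s].

Lemma cup_uniform r (e : {set cup_vertex r}) : e \in cup_edges r -> #|e| = 2%N.
Proof. by case/imsetP=> i _ ->; rewrite cards2. Qed.

Lemma cup_chain r (e : {set cup_vertex r}) : e \in cup_edges r ->
  {in e &, forall x y, x >=< y}.
Proof.
case/imsetP=> i _ -> x y; rewrite !inE => /orP[]/eqP-> /orP[]/eqP->;
by rewrite /Order.comparable /Order.le /= /cup_le ?eqxx ?orbT.
Qed.

Lemma cap_uniform s (e : {set cap_vertex s}) : e \in cap_edges s -> #|e| = 2%N.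
Proof. by case/imsetP=> i _ ->; rewrite cards2. Qed.

Lemma cap_chain s (e : {set cap_vertex s}) : e \in cap_edges s ->
  {in e &, forall x y, x >=< y}.
Proof.
case/imsetP=> i _ -> x y; rewrite !inE => /orP[]/eqP-> /orP[]/eqP->;
by rewrite /Order.comparable /Order.le /= /cap_le ?eqxx ?orbT.
Qed.

Definition cup (r : nat) : pograph 2 :=
  Pograph (@cup_uniform r) (@cup_chain r).

Definition cap (s : nat) : pograph 2 :=
  Pograph (@cap_uniform s) (@cap_chain s).

(* A colouring [c] is total on subsets of [Q], but [c] is only ever read on the
   images of edges, which are k-element chains of [Q]; for k = 2 these are the
   pairs of distinct comparable elements. *)
Definition is_copy (k : nat) (H : pograph k) (d : Order.disp_t)
    (Q : finPOrderType d) (C : eqType) (c : {set Q} -> C) (i : C)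
    (f : pg_vertex H -> Q) : Prop :=
  [/\ injective f,
      {homo f : x y / x <= y} &
      forall e : {set pg_vertex H}, e \in pg_edges H -> c (f @: e) = i].

Definition has_copy (k : nat) (H : pograph k) (d : Order.disp_t)
    (Q : finPOrderType d) (C : eqType) (c : {set Q} -> C) (i : C) : Prop :=
  exists f : pg_vertex H -> Q, is_copy c i f.

Definition boolean_lattice (N : nat) : finPOrderType _ := {set 'I_N}.

(* Colours 1 and 2 are [true] and [false]. *)
Definition boolean_arrows (k N : nat) (G1 G2 : pograph k) : Prop :=
  forall c : {set boolean_lattice N} -> bool,
    has_copy G1 c true \/ has_copy G2 c false.

Definition is_BR (k : nat) (G1 G2 : pograph k) (N : nat) : Prop :=
  boolean_arrows N G1 G2 /\
  forall M : nat, boolean_arrows M G1 G2 -> (N <= M)%N.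

Definition logb (R : realType) (b x : R) : R := (ln x / ln b)%R.

(* Main.v *)
Require Import Defs.
From mathcomp Require Import all_boot all_order all_algebra.
From mathcomp Require Import all_classical all_reals all_analysis.
From mathcomp Require Import fintype finset zify ring lra.

Import Order.TTheory GRing.Theory Num.Theory.

(* Write r = a + 1 and s = b + 1.

   Upper bound: a coloring without the cup and the cap gives every set at most
   a proper supersets in color 1 and at most b proper subsets in color 2, and
   the full set has no proper superset; hence the 3^N - 2^N comparable pairs
   number fewer than (a + b) 2^N.

   Lower bound: extending inclusion to a linear order, it suffices to color a
   chain of a + b + t + 1 points, t (t + 1) <= 2 a b, so that each point has at
   most a red pairs above it and at most b blue pairs below it, that is, the
   j-th point (from 0) has at least j - b red pairs below it.  The total of the
   capacities a meets the total of these demands exactly when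
   t (t + 1) <= 2 a b, and greedy balancing then realises all demands. *)

(** * Balanced families of sets *)

(** Greedy choice: each step adds a minimiser of [f] over the complement. *)
Lemma exists_lowest_subset (T : finType) (f : T -> nat) (d : nat) :
  (d <= #|T|)%N -> exists2 X : {set T}, #|X| = d &
    forall x y, x \in X -> y \notin X -> (f x <= f y)%N.
Proof.
elim: d => [_|d IHd ltdT].
  by exists set0 => [|x y]; rewrite ?cards0 ?inE.
have [X cardX lowX] := IHd (ltnW ltdT).
have /card_gt0P[z0] : (0 < #|~: X|)%N by have := cardsC X; lia.
rewrite inE => z0X; have [z zX minz] := @arg_minnP _ z0 (fun z => z \notin X) f z0X.
exists (z |: X) => [|x y]; first by rewrite cardsU1 zX cardX.
rewrite !inE negb_or => /orP[/eqP -> /andP[_ yX]|xX /andP[_ yX]].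
  exact: minz.
exact: lowX.
Qed.

(* Assigning each new set to the currently least covered points keeps the
   covering multiplicities within 1 of each other. *)
Lemma exists_balanced_sets (T : finType) (m : nat) (d : nat -> nat) :
  (forall j, (j < m)%N -> (d j <= #|T|)%N) ->
  exists2 X : nat -> {set T}, (forall j, (j < m)%N -> #|X j| = d j) &
    forall x y, (\sum_(0 <= j < m) (x \in X j)
                 <= (\sum_(0 <= j < m) (y \in X j)).+1)%N.
Proof.
elim: m => [_|m IHm hd].
  by exists (fun=> set0) => // x y; rewrite !big_geq.
have [j ltjm|X cardX balX] := IHm; first by apply: hd; lia.
pose f x := (\sum_(0 <= j < m) (x \in X j))%N.
have [Y cardY lowY] := @exists_lowest_subset _ f _ (hd m (ltnSn m)).
exists (fun j => if (j < m)%N then X j else Y) => [j|x y].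
  rewrite ltnS leq_eqVlt => /orP[/eqP ->|ltjm]; first by rewrite ltnn.
  by rewrite ltjm cardX.
have E z : (\sum_(0 <= j < m.+1) (z \in if (j < m)%N then X j else Y)
            = f z + (z \in Y))%N.
  rewrite big_nat_recr //= ltnn; congr addn.
  by apply: eq_big_nat => j /andP[_ ->].
rewrite !E; have bxy : (f x <= (f y).+1)%N := balX x y.
have [xY|xY] := boolP (x \in Y); have [yY|yY] := boolP (y \in Y); rewrite /=; try lia.
by have := lowY x y xY yY; lia.
Qed.

(** Column sums differ by at most 1, so an integer bound on their average, from above or from below,
    holds for every column. *)
Lemma balanced_incidence (m q : nat) (d : nat -> nat) :
  (forall j, (j < m)%N -> (d j <= q)%N) ->
  exists inc : nat -> nat -> bool,
  [/\ forall j, (j < m)%N -> (\sum_(0 <= o < q) inc j o = d j)%N,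
      forall B o, (\sum_(0 <= j < m) d j <= q * B)%N -> (o < q)%N ->
        (\sum_(0 <= j < m) inc j o <= B)%N &
      forall B o, (q * B <= \sum_(0 <= j < m) d j)%N -> (o < q)%N ->
        (B <= \sum_(0 <= j < m) inc j o)%N].
Proof.
move=> hd; have [j ltjm|X cardX balX] := @exists_balanced_sets 'I_q m d.
  by rewrite card_ord hd.
pose inc j o := [exists x : 'I_q, (x \in X j) && (val x == o)].
have incE j (x : 'I_q) : inc j x = (x \in X j).
  apply/existsP/idP => [[y /andP[yX /eqP/val_inj <-]] //|xX].
  by exists x; rewrite xX eqxx.
have rowE j : (j < m)%N -> (\sum_(0 <= o < q) inc j o = d j)%N.
  move=> ltjm; rewrite big_mkord -cardX // -sum1_card [RHS]big_mkcond /=.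
  by apply: eq_bigr => x _; rewrite incE; case: (x \in X j).
have colE (x : 'I_q) : (\sum_(0 <= j < m) inc j x)%N = (\sum_(0 <= j < m) (x \in X j))%N.
  by apply: eq_bigr => j _; rewrite incE.
have totE : (\sum_(0 <= j < m) d j = \sum_(x < q) \sum_(0 <= j < m) inc j x)%N.
  rewrite exchange_big; apply: eq_big_nat => j /andP[_ ltjm].
  by rewrite -rowE // big_mkord.
have sumB B : (\sum_(x < q) B = q * B)%N by rewrite sum_nat_const card_ord.
exists inc; split=> // B o; rewrite totE -sumB => leB ltoq.
  rewrite leqNgt; apply/negP => ltB; move: leB; apply/negP; rewrite -ltnNge.
  have le1 (x : 'I_q) : (B <= \sum_(0 <= j < m) inc j x)%N.
    by have := balX (Ordinal ltoq) x; rewrite -!colE /=; lia.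
  rewrite (bigD1 (Ordinal ltoq)) //= [X in (_ < X)%N](bigD1 (Ordinal ltoq)) //=.
  by rewrite -addSn leq_add // leq_sum.
rewrite leqNgt; apply/negP => ltB; move: leB; apply/negP; rewrite -ltnNge.
have le1 (x : 'I_q) : (\sum_(0 <= j < m) inc j x <= B)%N.
  by have := balX x (Ordinal ltoq); rewrite -!colE /=; lia.
rewrite (bigD1 (Ordinal ltoq)) //= [X in (_ < X)%N](bigD1 (Ordinal ltoq)) //=.
by rewrite -addSn leq_add // leq_sum.
Qed.

(** * Coloring a chain *)

Lemma sum_nat_geq (m n c : nat) :
  (\sum_(m <= i < n) (c <= i) = n - maxn m c)%N.
Proof.
elim: n => [|n IHn]; first by rewrite big_geq.
have [ltnm|lemn] := ltnP n m; first by rewrite big_geq; lia.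
by rewrite big_nat_recr //= IHn; case: leqP; lia.
Qed.

(** Double counting of the pairs i < j, by lower end and by upper end. *)
Lemma exchange_big_triangle (n : nat) (F : nat -> nat -> nat) :
  (\sum_(0 <= i < n) \sum_(i.+1 <= j < n) F i j
   = \sum_(0 <= j < n) \sum_(0 <= i < j) F i j)%N.
Proof.
elim: n => [|n IHn]; first by rewrite !big_geq.
rewrite [LHS]big_nat_recr //= [RHS]big_nat_recr //= -IHn [X in (_ + X)%N]big_geq // addn0 -big_split /=.
by apply: eq_big_nat => i /andP[_ ltin]; rewrite big_nat_recr.
Qed.

Lemma sum_iota_double (n : nat) : (2 * \sum_(0 <= k < n) k = n * n.-1)%N.
Proof.
elim: n => [|n IHn]; first by rewrite big_geq.
by rewrite big_nat_recr //= mulnDr IHn; case: n {IHn} => //= n; nia.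
Qed.

(* The first [b] points need no incoming red pair.  The point [b + k] takes
   [minn k b] of the first [b] points, chosen in a balanced way, and all points
   from [2 * b] on. *)
Lemma inner_coloring (a b t : nat) : (t * t.+1 <= 2 * (a * b))%N ->
  exists red : nat -> nat -> bool,
    (forall i, (i < b + t)%N -> (\sum_(i.+1 <= j < b + t) red i j <= a)%N) /\
    (forall j, (j < b + t)%N -> (\sum_(0 <= i < j) red i j = j - b)%N).
Proof.
move=> htab.
have [|inc [rowE colle _]] := @balanced_incidence t b (fun k => minn k b).
  by move=> k _; lia.
pose red i j := (b <= j)%N && (if (i < b)%N then inc (j - b)%N i else (b + b <= i)%N).
exists red; split=> [i ltibt|j ltjbt].
  have [ltib|leib] := ltnP i b; last first.
    apply: (@leq_trans (\sum_(i.+1 <= j < b + t) (b + b <= i))%N).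
      apply: leq_sum => j _; rewrite /red ltnNge leib /=.
      by case: (b <= j)%N.
    rewrite sum_nat_const_nat.
    (* When i >= 2b, at most t - b - 1 points follow; were this above [a], then t > a + b + 1 and
       t(t+1) > (a+b)^2 >= 4ab. *)
    by case: (leqP (b + b) i) => h /=; [nia | rewrite muln0].
  rewrite (@big_cat_nat _ _ _ b) //=; last by lia.
  rewrite big_nat_cond big1 => [|j]; last first.
    by rewrite andbT /red => /andP[_ ltjb]; rewrite leqNgt ltjb.
  rewrite add0n -{1}[b]add0n big_addn addKn.
  rewrite (eq_bigr (fun k => nat_of_bool (inc k i))) => [|k _]; last first.
    by rewrite /red ltib addnK leq_addl.
  (* The total demand on the first [b] points is at most t(t-1)/2 <= ab. *)
  apply: colle => //; apply: (@leq_trans (\sum_(0 <= k < t) k)%N).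
    by apply: leq_sum => k _; exact: geq_minl.
  by have := sum_iota_double t; nia.
have [ltjb|lebj] := ltnP j b.
  rewrite big1 => [|i _]; first by lia.
  by rewrite /red leqNgt ltjb.
rewrite (@big_cat_nat _ _ _ b) //=.
rewrite (eq_big_nat _ _ (F2 := fun i => nat_of_bool (inc (j - b)%N i))); last first.
  by move=> i /andP[_ ltib]; rewrite /red lebj ltib.
rewrite rowE; last by lia.
rewrite [X in (_ + X)%N](eq_big_nat _ _ (F2 := fun i => nat_of_bool (b + b <= i)%N)); last first.
  by move=> i /andP[lebi _]; rewrite /red lebj ltnNge lebi.
(* With k = j - b, the two ranges give min(k, b) and k - b (truncated at 0) red pairs, [k] in
   all. *)
by rewrite sum_nat_geq; lia.
Qed.

(* The first [b + t] points are coloured by [inner_coloring], the last [a + 1]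
   are pairwise red, and the red out-degree still free at the first [b + t]
   points is spread evenly over the last [a + 1], each of which needs [t]. *)
Lemma chain_coloring (a b t : nat) : (t * t.+1 <= 2 * (a * b))%N ->
  exists red : nat -> nat -> bool,
    (forall i, (i < a + b + t.+1)%N ->
       (\sum_(i.+1 <= j < a + b + t.+1) red i j <= a)%N) /\
    (forall j, (j < a + b + t.+1)%N -> (\sum_(0 <= i < j) ~~ red i j <= b)%N).
Proof.
move=> htab; have [red1 [out1 in1]] := inner_coloring a b t htab.
pose free i := (a - \sum_(i.+1 <= j < b + t) red1 i j)%N.
have [i _|inc [rowE _ colge]] := @balanced_incidence (b + t) a.+1 free.
  by rewrite /free; lia.
(* The capacities total (b+t)a, of which t(t-1)/2 is spent; the rest reaches (a+1)t exactly when
   t(t+1) <= 2ab. *)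
have sum_free : (a.+1 * t <= \sum_(0 <= i < b + t) free i)%N.
  have E : (\sum_(0 <= i < b + t) free i + \sum_(0 <= k < t) k = (b + t) * a)%N.
    rewrite -[(b + t)%N in RHS]subn0 -sum_nat_const_nat.
    have -> : (\sum_(0 <= k < t) k
               = \sum_(0 <= i < b + t) \sum_(i.+1 <= j < b + t) red1 i j)%N.
      rewrite exchange_big_triangle [RHS](eq_big_nat _ _ (F2 := fun j => (j - b)%N)); last first.
        by move=> j /andP[_]; exact: in1.
      rewrite [RHS](@big_cat_nat _ _ _ b) ?leq_addr //= [X in (X + _)%N]big_nat_cond.
      rewrite [X in (X + _)%N]big1 => [|j]; last by lia.
      rewrite add0n -{1}[b]add0n big_addn addKn.
      by apply: eq_bigr => k _; rewrite addnK.
    rewrite -big_split /=; apply: eq_big_nat => i /andP[_ /out1]; rewrite /free; lia.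
  by have := sum_iota_double t; nia.
pose red i j := if (j < b + t)%N then red1 i j
                else if (i < b + t)%N then inc i (j - (b + t))%N else true.
exists red; split=> [i ltin|j ltjn].
  have [ltibt|leibt] := ltnP i (b + t)%N; last first.
    apply: (@leq_trans (\sum_(i.+1 <= j < a + b + t.+1) 1)%N).
      by apply: leq_sum => j _; case: (red i j).
    by rewrite sum_nat_const_nat; lia.
  rewrite (@big_cat_nat _ _ _ (b + t)) //=; last by lia.
  rewrite (eq_big_nat _ _ (F2 := fun j => nat_of_bool (red1 i j))); last first.
    by move=> j /andP[_ ltjbt]; rewrite /red ltjbt.
  rewrite -{2}[(b + t)%N]add0n big_addn.
  have -> : (a + b + t.+1 - (b + t) = a.+1)%N by lia.
  rewrite [X in (_ + X)%N](eq_big_nat _ _ (F2 := fun o => nat_of_bool (inc i o))); last first.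
    by move=> o _; rewrite /red ltnNge leq_addl ltibt addnK.
  by rewrite rowE // /free; have := out1 i ltibt; lia.
suff le_in : (j <= b + \sum_(0 <= i < j) red i j)%N.
  have : (\sum_(0 <= i < j) red i j + \sum_(0 <= i < j) ~~ red i j = j)%N.
    rewrite -big_split /= -[RHS]muln1 -[j in RHS]subn0 -sum_nat_const_nat.
    by apply: eq_bigr => i _; case: (red i j).
  by lia.
have [ltjbt|lejbt] := ltnP j (b + t)%N.
  rewrite (eq_bigr (fun i => nat_of_bool (red1 i j))); last first.
    by move=> i _; rewrite /red ltjbt.
  by rewrite in1 //; lia.
rewrite (@big_cat_nat _ _ _ (b + t)) //=.
rewrite (eq_big_nat _ _ (F2 := fun i => nat_of_bool (inc i (j - (b + t))%N))); last first.
  by move=> i /andP[_ ltibt]; rewrite /red ltnNge lejbt ltibt.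
rewrite addnA [X in (_ + X)%N](eq_big_nat _ _ (F2 := fun=> 1%N)); last first.
  by move=> i /andP[leibt _]; rewrite /red !ltnNge lejbt leibt.
rewrite sum_nat_const_nat.
(* The column supplies at least [t], and the j - (b+t) earlier points of the last block are all red:
   at least j - b together. *)
by have := colge t (j - (b + t))%N sum_free; lia.
Qed.

(** * Cups and caps as degree conditions *)

Lemma exists_injection_in (T : finType) (A : {set T}) (r : nat) :
  (r <= #|A|)%N -> exists2 g : 'I_r -> T, injective g & forall i, g i \in A.
Proof.
move=> lerA; exists (fun i => enum_val (widen_ord lerA i)) => [i j|i].
  by move/enum_val_inj/(congr1 val) => /= eqij; exact: val_inj.
exact: enum_valP.
Qed.

(** The leaves of a cup are pairwise incomparable, so any [r] distinct color-[i] partners above [x]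
    can serve as their images. *)
Lemma has_copy_cupP (d : Order.disp_t) (Q : finPOrderType d) (C : eqType)
    (c : {set Q} -> C) (i : C) (r : nat) :
  has_copy (cup r) c i <->
  exists x : Q, (r <= #|[set y | (x < y)%O & c [set x; y] == i]|)%N.
Proof.
split=> [[f [injf homf colf]]|[x /exists_injection_in[g injg gP]]].
  exists (f None); pose g (j : 'I_r) := f (Some j).
  have injg : injective g by move=> j k /injf[].
  rewrite -[r in (r <= _)%N]card_ord -cardsT -(card_imset _ injg).
  apply/subset_leq_card/subsetP => _ /imsetP[j _ ->]; rewrite inE lt_neqAle.
  rewrite (inj_eq injf) /= homf ?orbT //=.
  rewrite -(colf [set None; Some j]); first by rewrite imsetU1 imset_set1.
  exact: imset_f.
have ltxg j : (x < g j)%O by have := gP j; rewrite inE => /andP[].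
exists (fun v => if v is Some j then g j else x); split=> [[j|] [k|]|[j|] [k|]|e].
- by move/injg ->.
- by move=> E; have := ltxg j; rewrite E ltxx.
- by move=> E; have := ltxg k; rewrite -E ltxx.
- by [].
- by move=> h; have /orP[/eqP[->]|] : cup_le (Some j) (Some k) := h.
- by move=> h; have := h : cup_le (Some j) None.
- by move=> _; exact: ltW.
- by [].
case/imsetP=> j _ ->; rewrite imsetU1 imset_set1.
by have := gP j; rewrite inE => /andP[_ /eqP].
Qed.

Lemma has_copy_capP (d : Order.disp_t) (Q : finPOrderType d) (C : eqType)
    (c : {set Q} -> C) (i : C) (s : nat) :
  has_copy (cap s) c i <->
  exists y : Q, (s <= #|[set x | (x < y)%O & c [set x; y] == i]|)%N.
Proof.
split=> [[f [injf homf colf]]|[y /exists_injection_in[g injg gP]]].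
  exists (f None); pose g (j : 'I_s) := f (Some j).
  have injg : injective g by move=> j k /injf[].
  rewrite -[s in (s <= _)%N]card_ord -cardsT -(card_imset _ injg).
  apply/subset_leq_card/subsetP => _ /imsetP[j _ ->]; rewrite inE lt_neqAle.
  rewrite (inj_eq injf) /= homf ?orbT //=.
  rewrite -(colf [set Some j; None]); first by rewrite imsetU1 imset_set1.
  exact: imset_f.
have ltgy j : (g j < y)%O by have := gP j; rewrite inE => /andP[].
exists (fun v => if v is Some j then g j else y); split=> [[j|] [k|]|[j|] [k|]|e].
- by move/injg ->.
- by move=> E; have := ltgy j; rewrite E ltxx.
- by move=> E; have := ltgy k; rewrite -E ltxx.
- by [].
- by move=> h; have /orP[/eqP[->]|] : cap_le (Some j) (Some k) := h.
- by move=> _; exact: ltW.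
- by move=> h; have := h : cap_le None (Some k).
- by [].
case/imsetP=> j _ ->; rewrite imsetU1 imset_set1.
by have := gP j; rewrite inE => /andP[_ /eqP].
Qed.

(** * Transfer from a chain to a poset *)

(** Sorting by the size of the principal down-set works, since this size grows strictly along
    [<]. *)
Lemma exists_linear_extension (d : Order.disp_t) (Q : finPOrderType d) :
  exists h : Q -> nat, [/\ injective h, forall x, (h x < #|Q|)%N &
    forall x y, (x < y)%O -> (h x < h y)%N].
Proof.
pose key (x : Q) := #|[set y | (y <= x)%O]|.
pose leT x y := (key x <= key y)%N.
pose s := sort leT (enum Q).
have mems x : x \in s by rewrite mem_sort mem_enum.
have sorts : sorted leT s by apply: sort_sorted => x y; exact: leq_total.
exists (fun x => index x s); split=> [x y|x|x y ltxy].
- exact: index_inj.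
- by rewrite cardE -(size_sort leT) index_mem.
rewrite ltnNge; apply/negP => leyx.
have leT_trans : transitive leT by move=> u v w; exact: leq_trans.
have leT_refl : reflexive leT by move=> u; exact: leqnn.
have := sorted_leq_index leT_trans leT_refl sorts y x (mems y) (mems x) leyx.
rewrite /leT leqNgt => /negP; apply; apply: proper_card; apply/properP; split.
  by apply/subsetP => z; rewrite !inE => /le_trans; apply; exact: ltW.
by exists y; rewrite !inE ?lexx // lt_geF.
Qed.

(** Bounds a degree in the poset by the degree of the corresponding point of the chain. *)
Lemma card_le_sum_nat (T : finType) (A : {set T}) (h : T -> nat) (m n : nat)
    (P : pred nat) : injective h ->
  (forall x, x \in A -> [&& (m <= h x)%N, (h x < n)%N & P (h x)]) ->
  (#|A| <= \sum_(m <= j < n) P j)%N.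
Proof.
move=> injh hA; have -> : (\sum_(m <= j < n) P j = size (seq.filter P (index_iota m n)))%N.
  rewrite size_filter -sum1_count [RHS]big_mkcond.
  by apply: eq_bigr => j _; case: (P j).
rewrite cardE -(size_map h); apply: uniq_leq_size.
  by rewrite map_inj_uniq ?enum_uniq.
move=> _ /mapP[x xA ->]; rewrite mem_filter mem_index_iota.
by rewrite mem_enum in xA; have /and3P[-> -> ->] := hA x xA.
Qed.

Lemma exists_avoiding_coloring (d : Order.disp_t) (Q : finPOrderType d) (a b t : nat) :
  (t * t.+1 <= 2 * (a * b))%N -> (#|Q| <= a + b + t.+1)%N ->
  exists c : {set Q} -> bool,
    ~ has_copy (cup a.+1) c true /\ ~ has_copy (cap b.+1) c false.
Proof.
move=> htab leQ; have [red [outred inred]] := chain_coloring a b t htab.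
have [h [injh ltQ monoh]] := exists_linear_extension d Q.
(* A color depends on an unordered set; the guard [x < y] recovers the orientation of a pair. *)
pose c (E : {set Q}) :=
  [forall x in E, forall y in E, (x < y)%O ==> red (h x) (h y)].
have cE x y : (x < y)%O -> c [set x; y] = red (h x) (h y).
  move=> ltxy; apply/idP/idP => [/forall_inP/(_ x)|redxy].
    rewrite !inE eqxx => /(_ isT)/forall_inP/(_ y).
    by rewrite !inE eqxx orbT ltxy => /(_ isT).
  apply/forall_inP => u; rewrite !inE => uxy; apply/forall_inP => v; rewrite !inE => vxy.
  case/orP: uxy vxy => /eqP -> /orP[] /eqP ->; rewrite ?ltxx ?redxy ?implybT //.
  by rewrite lt_gtF.
have ltn x : (h x < a + b + t.+1)%N by exact: leq_trans (ltQ x) leQ.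
exists c; split=> [/has_copy_cupP[x]|/has_copy_capP[y]]; apply/negP; rewrite -leqNgt.
  apply: leq_trans (outred (h x) (ltn x)); apply: (card_le_sum_nat _ _ h _ _ (red (h x))) => // y.
  by rewrite inE => /andP[ltxy]; rewrite cE // ltn monoh // => /eqP ->.
apply: leq_trans (inred (h y) (ltn y)); apply: (card_le_sum_nat _ _ h _ _ (fun i => ~~ red i (h y))) => // x.
by rewrite inE => /andP[ltxy]; rewrite cE // monoh // => /eqP ->.
Qed.

(** * Counting comparable pairs in the Boolean lattice *)

(** The product of |T| factors 2 + 1 is expanded over the set [A] of factors contributing 2. The sum
    counts the pairs of subsets x <= y. *)
Lemma sum_powerset (T : finType) : (\sum_(A : {set T}) 2 ^ #|A| = 3 ^ #|T|)%N.
Proof.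
rewrite -[RHS]prod_nat_const.
rewrite (eq_bigr (fun=> (2 + 1)%N)) // bigA_distr; apply: eq_bigr => A _.
by rewrite -big_mkcond prod_nat_const.
Qed.

Lemma card_boolean_lattice (N : nat) : #|boolean_lattice N| = (2 ^ N)%N.
Proof. by rewrite -cardsT -powersetT card_powerset cardsT card_ord. Qed.

Lemma card_lt_boolean_lattice (N : nat) (y : boolean_lattice N) :
  (#|[set x | (x < y)%O]|.+1 = 2 ^ #|(y : {set 'I_N})|)%N.
Proof.
rewrite -card_powerset -add1n [RHS](cardsD1 y) inE subxx; congr addn.
apply: eq_card => x; rewrite !inE lt_neqAle.
by rewrite Order.SetSubsetOrder.leEsubset.
Qed.

Lemma boolean_arrows_cup_cap (N a b : nat) : (0 < a)%N ->
  ((a + b).+1 * 2 ^ N <= 3 ^ N)%N -> boolean_arrows N (cup a.+1) (cap b.+1).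
Proof.
move=> a_gt0 leN c; apply: contrapT => /not_orP[nocup nocap].
pose up x := [set y : boolean_lattice N | (x < y)%O & c [set x; y] == true].
pose down y := [set x : boolean_lattice N | (x < y)%O & c [set x; y] == false].
have le_up x : (#|up x| <= a)%N.
  by rewrite leqNgt; apply/negP => h; apply: nocup; apply/has_copy_cupP; exists x.
have le_down y : (#|down y| <= b)%N.
  by rewrite leqNgt; apply/negP => h; apply: nocap; apply/has_copy_capP; exists y.
have cardL := card_boolean_lattice N.
(* The 3^N pairs x <= y split into color 1, color 2 and the 2^N diagonal ones. *)
have count_pairs : (\sum_x #|up x| + \sum_y #|down y| + 2 ^ N = 3 ^ N)%N.
  have -> : (\sum_x #|up x| = \sum_y #|[set x | (x < y)%O & c [set x; y] == true]|)%N.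
    under eq_bigr do rewrite -sum1_card big_mkcond.
    rewrite exchange_big; apply: eq_bigr => y _; rewrite -sum1_card [RHS]big_mkcond.
    by apply: eq_bigr => x _; rewrite !inE.
  rewrite -[in RHS](card_ord N) -sum_powerset -cardL -sum1_card -!big_split /=.
  apply: eq_bigr => y _; rewrite -card_lt_boolean_lattice addn1; congr S.
  rewrite -cardsUI [X in (_ + X)%N](_ : _ = 0)%N ?addn0.
    by apply: eq_card => x; rewrite !inE -andb_orr; case: (c _); rewrite andbT.
  by apply: eq_card0 => x; rewrite !inE; case: (c _); rewrite !andbF.
have sum_down : (\sum_y #|down y| <= 2 ^ N * b)%N.
  by rewrite -cardL -sum_nat_const leq_sum.
(* Nothing lies above the full set; its unspent allowance [a], which is positive, makes the bound
   strict. *)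
have sum_up : (\sum_x #|up x| < 2 ^ N * a)%N.
  rewrite -cardL -sum_nat_const (bigD1 [set: 'I_N]) //=.
  rewrite [X in (_ < X)%N](bigD1 [set: 'I_N]) //= -addSn leq_add ?leq_sum //.
  rewrite (_ : up _ = set0) ?cards0 //; apply/setP => y; rewrite !inE.
  by rewrite lt_leAnge !Order.SetSubsetOrder.leEsubset finset.subsetT andbF.
by move: leN count_pairs sum_down sum_up; lia.
Qed.

(** * Logarithms, floors and the final bounds *)

Local Open Scope ring_scope.

Lemma logb_le_nat (R : realType) (b x : R) (n : nat) : 1 < b -> 0 < x ->
  (logb b x <= n%:R) = (x <= b ^+ n).
Proof.
move=> b_gt1 x_gt0; have b_gt0 : 0 < b by exact: lt_trans b_gt1.
rewrite /logb ler_pdivrMr ?ln_gt0 // mulr_natl -lnXn //.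
by rewrite ler_ln // posrE exprn_gt0.
Qed.

(** With y^2 = 1 + 8m, t <= (y-1)/2 gives (2t+1)^2 <= 1 + 8m, that is t(t+1) <= 2m. *)
Lemma floor_triangular_root (R : realType) (m : nat) :
  exists2 t : nat, (t * t.+1 <= 2 * m)%N &
    Num.floor ((Num.sqrt (1 + 8 * m%:R) - 1) / 2 : R) = t%:Z.
Proof.
set y : R := Num.sqrt _; have m_ge0 : 0 <= m%:R :> R by [].
have y2 : y ^+ 2 = 1 + 8 * m%:R by rewrite sqr_sqrtr //; lra.
have y_ge0 : 0 <= y by exact: sqrtr_ge0.
have y_ge1 : 1 <= y by nra.
have : 0 <= Num.floor ((y - 1) / 2) by rewrite floor_ge0; lra.
have := floor_le ((y - 1) / 2); case: (Num.floor _) => // t let_y _.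
exists t => //; rewrite -(ler_nat R) !natrM -natr1.
have t_ge0 : 0 <= t%:R :> R by [].
have {}let_y : t%:R <= (y - 1) / 2 by [].
by nra.
Qed.

Theorem theorem3p7 (R : realType) (r s : nat) (hr : (2 <= r)%N) (hs : (2 <= s)%N) :
  exists N : nat,
    [/\ is_BR (cup r) (cap s) N,
        logb 2 ((Num.floor ((Num.sqrt (1 + 8 * (r%:R - 1) * (s%:R - 1)) - 1) / 2 : R))%:~R
                + r%:R + s%:R) <= N%:R :> R &
        N%:Z <= Num.ceil (logb (3 / 2) (r%:R + s%:R - 1) : R)].
Proof.
case: r hr => // a a_gt0; case: s hs => // b _.
have -> : 1 + 8 * (a.+1%:R - 1) * (b.+1%:R - 1) = 1 + 8 * (a * b)%N%:R :> R.
  by rewrite -!natr1 !addrK natrM mulrA.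
have -> : a.+1%:R + b.+1%:R - 1 = (a + b).+1%:R :> R.
  by rewrite -!natr1 natrD; ring.
have [t letab ->] := floor_triangular_root R (a * b).
have gt1 : 1 < 3 / 2 :> R by lra.
have : 0 <= Num.ceil (logb (3 / 2) (a + b).+1%:R : R).
  rewrite ceil_ge0; apply: (@lt_le_trans _ _ 0); first by rewrite ltrN10.
  by rewrite /logb divr_ge0 ?ln_ge0 ?ler1n // ltW.
have := ceil_ge (logb (3 / 2) (a + b).+1%:R : R).
case: (Num.ceil _) => // n0 le_n0 _.
(* [n0] is the ceiling in the upper bound; [le_n0] unwinds to (a+b+1) 2^n0 <= 3^n0. *)
have arrows_n0 : boolean_arrows n0 (cup a.+1) (cap b.+1).
  apply: boolean_arrows_cup_cap => //; move: le_n0.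
  rewrite [X in _ <= X -> _](_ : _ = n0%:R) // logb_le_nat ?ltr0n // expr_div_n.
  by rewrite ler_pdivlMr ?exprn_gt0 // -!natrX -natrM ler_nat.
have exN : exists n, `[<boolean_arrows n (cup a.+1) (cap b.+1)>].
  by exists n0; apply/asboolP.
case: (ex_minnP exN) => N /asboolP arrows_N minN.
have {}minN M : boolean_arrows M (cup a.+1) (cap b.+1) -> (N <= M)%N.
  by move=> h; apply: minN; apply/asboolP.
exists N; split=> //; last by rewrite lez_nat minN.
(* As r = a + 1 and s = b + 1, the argument is a + b + t + 2, one more than the size up to which an
   avoiding coloring exists. *)
rewrite [X in logb 2 X](_ : _ = (a + b + t.+2)%:R); last first.
  by rewrite -!natr1 !natrD -!natr1 -pmulrn; ring.
rewrite logb_le_nat ?ltr1n ?ltr0n ?addnS // -natrX ler_nat ltnNge -addnS.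
apply/negP => leN; have cardL : (#|boolean_lattice N| <= a + b + t.+1)%N.
  by rewrite card_boolean_lattice.
have [c [nocup nocap]] := exists_avoiding_coloring _ _ a b t letab cardL.
by case: (arrows_N c).
Qed.
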